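(* Let $(X_n)_{n\ge0}$ be a stationary $\mathbb{R}^d$-valued process having the multiple mixing property on a Banach space $(\mathcal{B},\|\cdot\|)$ of measurable functions $\mathbb{R}^d\to\mathbb{R}$, with constants $0<\theta<1$ and $r\ge1$. Then for every integer $p\ge1$ there is a constant $K$, which does not depend on $n$ or $\varphi$, such that for all $n\ge1$ and all $\varphi\in\mathcal{B}$ with $E(\varphi(X_0))=0$ and $\sup_x|\varphi(x)|\le1$, $$E\big[S_n(\varphi)^{2p}\big]\le K\sum_{i=1}^p n^i\,\|\varphi(X_0)\|_r^i\,\log^{2p-i}(\|\varphi\|+\theta^{-1})$$ and $$\big|E\big[S_n(\varphi)^{2p+1}\big]\big|\le K\sum_{i=1}^p n^i\,\|\varphi(X_0)\|_r^i\,\log^{2p-i+1}(\|\varphi\|+\theta^{-1}).$$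
   Context: $S_n(\varphi)=\sum_{i=0}^{n-1}\varphi(X_i)$; $\|\cdot\|_r$ is the $L^r$-norm of a random variable and $\|\varphi\|$ the norm of $\mathcal{B}$. Multiple mixing property: for a Banach space $(\mathcal{B},\|\cdot\|)$ of measurable functions $\varphi:\mathbb{R}^d\to\mathbb{R}$, the process $(X_n)_{n\ge0}$ has the multiple mixing property with respect to (on) $\mathcal{B}$ if there exist constants $0<\theta<1$ and $r\ge1$ such that for any integer $p\ge1$ there exist a positive constant $C$, an integer $\ell$ and a polynomial function $P$ of $p$ variables (not depending on $\varphi$) such that for any $i_1,\dots,i_p\in\mathbb{N}=\{0,1,2,\dots\}$, any $q\in\{1,\dots,p\}$ and any $\varphi\in\mathcal{B}$ with $E\varphi(X_0)=0$ and $\|\varphi\|_\infty\le1$, $$|\mathrm{Cov}(\varphi(X_0)\varphi(X_{i_1^*})\cdots\varphi(X_{i_{q-1}^*}),\ \varphi(X_{i_q^*})\cdots\varphi(X_{i_p^*}))|\le C\|\varphi(X_0)\|_r\|\varphi\|^\ell P(i_1,\dots,i_p)\theta^{i_q},$$ where $i_k^*=\sum_{j=1}^k i_j$. *)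

(* Defs.v *)
From HB Require Import structures.
From mathcomp Require Import all_boot all_order all_algebra.
From mathcomp Require Import all_classical all_reals all_analysis.
(* Not imported: its notations clash with those of MathComp-Analysis. *)
From mathcomp.multinomials Require mpoly.

Set Implicit Arguments.
Unset Strict Implicit.
Unset Printing Implicit Defensive.
Import Order.TTheory GRing.Theory Num.Theory.
Import numFieldNormedType.Exports.

Local Open Scope classical_set_scope.
Local Open Scope ring_scope.

(* R^d is [d.-tuple R] with the product sigma-algebra of the Borel
   sigma-algebra of R, which is the Borel sigma-algebra of R^d. *)

(* Equality of the finite-dimensional distributions of (X_n) and (X_(h+n)). *)
Definition stationary (R : realType) (disp : measure_display)
    (Omega : measurableType disp) (P : probability Omega R) (d : nat)
    (X : nat -> {RV P >-> d.-tuple R}) : Prop :=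
  forall (h m : nat) (A : set (m.-tuple (d.-tuple R))), measurable A ->
    pushforward P (fun w => [tuple X (h + j)%N w | j < m]) A =
    pushforward P (fun w => [tuple X j w | j < m]) A.
Arguments stationary {R disp Omega} P {d} X.

(* A Banach space of measurable functions is an abstract Banach space B
   together with [ev], which identifies (linearly and injectively) an element
   of B with a measurable function.  The norm of B is unrelated to [ev]. *)
Definition measurable_function_space (R : realType) (d : nat)
    (B : completeNormedModType R) (ev : B -> d.-tuple R -> R) : Prop :=
  [/\ forall (a : R) (f g : B) x, ev (a *: f + g) x = a * ev f x + ev g x,
      injective ev
    & forall f : B, measurable_fun [set: d.-tuple R] (ev f)].

Definition rv_norm (R : realType) (disp : measure_display)
    (Omega : measurableType disp) (P : probability Omega R)
    (r : R) (Y : Omega -> R) : R :=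
  fine (Lnorm P r%:E (EFin \o Y)).

(* i^*_k = i_1 + ... + i_k, where i_(j+1) is encoded as [i j], j < p. *)
Definition partial_index (p : nat) (i : 'I_p -> nat) (k : nat) : nat :=
  (\sum_(j < p | (j < k)%N) i j)%N.

(* As for the indices, [q : 'I_p] stands for the element q + 1 of {1, ..., p}:
   the first factor of the covariance is the product over the times i^*_k with
   0 <= k < q + 1 and the second one over those with q + 1 <= k <= p.
   The exponent l of the norm is a natural number: a negative power would be
   meaningless at f = 0. *)
Definition multiple_mixing (R : realType) (disp : measure_display)
    (Omega : measurableType disp) (P : probability Omega R) (d : nat)
    (X : nat -> {RV P >-> d.-tuple R})
    (B : completeNormedModType R) (ev : B -> d.-tuple R -> R)
    (theta r : R) : Prop :=
  [/\ 0 < theta, theta < 1, 1 <= r &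
    forall p : nat, (1 <= p)%N ->
    exists (C : R) (l : nat) (Q : mpoly.mpoly p R),
      0 < C /\
      forall (i : 'I_p -> nat) (q : 'I_p) (f : B),
        ('E_P[ev f \o X 0%N] = 0)%E ->
        (forall x, `|ev f x| <= 1) ->
        (`| covariance P
              (fun w => (\prod_(k < p.+1 | (k <= q)%N)
                           ev f (X (partial_index i k) w))%R)
              (fun w => (\prod_(k < p.+1 | (q < k)%N)
                           ev f (X (partial_index i k) w))%R) |
         <= (C * rv_norm P r (ev f \o X 0%N) * `|f| ^+ l
               * mpoly.meval (fun j => (i j)%:R) Q * theta ^+ i q)%:E)%E].
Arguments multiple_mixing {R disp Omega} P {d} X {B} ev theta r.

Definition Birkhoff_sum (T E : Type) (R : realType) (X : nat -> T -> E)
    (n : nat) (phi : E -> R) (w : T) : R :=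
  \sum_(0 <= i < n) phi (X i w).

(* Main.v *)
Require Import Defs.
From HB Require Import structures.
From mathcomp Require Import all_boot all_order all_algebra.
From mathcomp Require Import all_classical all_reals all_analysis.
From mathcomp Require Import measurable_realfun ring.
From mathcomp.multinomials Require mpoly.
Import Order.TTheory GRing.Theory Num.Theory.
Import numFieldNormedType.Exports.
Local Open Scope classical_set_scope.
Local Open Scope ring_scope.

(* Put u = ||f(X_0)||_r and L = log(||f|| + 1/theta).  Expanding the power and
   ordering the times, E[S_n^m] is at most a constant times
   a_m = n * sum_s |E prod_k f(X_(t_k))|, where s runs over the m - 1 gaps < n
   of the times t_1 = 0 <= t_2 <= ... and stationarity yields the factor n.
   Cutting each expectation at its largest gap b gives
   a_m <= n * (sum of covariances) + sum_q a_q a_(m-q).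
   Each covariance is at most both 2u and const * u ||f||^l b^M theta^b; as the
   second bound only takes over for b of order L, the sum over the m - 1 gaps
   is O(u L^(m-1)).  Since a_1 = 0, induction gives
   a_m = O(sum_(1 <= i <= m/2) (n u)^i L^(m-i)). *)

(** * Sums over lists of a given length *)

(** Lists, not tuples: gap lists of every length share one type, so [take], [drop] and concatenation
    need no casts. *)
Fixpoint msum {R : nmodType} {I : Type} (r : seq I) (m : nat)
    (F : seq I -> R) : R :=
  if m is m'.+1 then \sum_(a <- r) msum r m' (fun s => F (a :: s)) else F [::].

Lemma eq_msum {R : nmodType} {I : Type} (r : seq I) m (F G : seq I -> R) :
  (forall s, size s = m -> F s = G s) -> msum r m F = msum r m G.
Proof.
elim: m F G => [|m IH] F G FG /=; first exact: FG.
by apply: eq_bigr => a _; apply: IH => s sm; apply: FG; rewrite /= sm.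
Qed.

Lemma msum_map {R : nmodType} {I J : Type} (h : J -> I) (r : seq J) m
    (F : seq I -> R) :
  msum (map h r) m F = msum r m (fun s => F (map h s)).
Proof.
elim: m F => [|m IH] F //=; rewrite big_map.
by apply: eq_bigr => a _; exact: IH.
Qed.

Lemma msumD {R : nmodType} {I : Type} (r : seq I) m (F G : seq I -> R) :
  msum r m (fun s => F s + G s) = msum r m F + msum r m G.
Proof.
elim: m F G => [|m IH] F G //=; rewrite -big_split /=.
by apply: eq_bigr => a _; exact: IH.
Qed.

Lemma msum0 {R : nmodType} {I : Type} (r : seq I) m :
  msum r m (fun=> 0) = 0 :> R.
Proof. by elim: m => [|m IH] //=; rewrite big1. Qed.

Lemma msum_sum {R : nmodType} {I J : Type} (r : seq I) m (t : seq J)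
    (F : J -> seq I -> R) :
  msum r m (fun s => \sum_(j <- t) F j s) = \sum_(j <- t) msum r m (F j).
Proof.
elim: t => [|j t IH].
  by rewrite big_nil -[RHS](msum0 r m); apply: eq_msum => s _; rewrite big_nil.
rewrite big_cons -IH -msumD; apply: eq_msum => s _; exact: big_cons.
Qed.

Lemma msumZ {R : pzSemiRingType} {I : Type} (r : seq I) m c (F : seq I -> R) :
  msum r m (fun s => c * F s) = c * msum r m F.
Proof.
elim: m F => [|m IH] F //=; rewrite mulr_sumr.
by apply: eq_bigr => a _; exact: IH.
Qed.

(** Serves twice: to expand a power of a Birkhoff sum, and to evaluate the sum over gap lists of a
    product of one-gap bounds. *)
Lemma msum_prod {R : pzSemiRingType} {I : Type} (r : seq I) m (g : I -> R) :
  msum r m (fun s => \prod_(a <- s) g a) = (\sum_(a <- r) g a) ^+ m.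
Proof.
elim: m => [|m IH] /=; first by rewrite big_nil.
rewrite exprS mulr_suml; apply: eq_bigr => a _; rewrite -IH -msumZ.
by apply: eq_msum => s _; exact: big_cons.
Qed.

Lemma le_msum {R : numDomainType} {I : Type} (r : seq I) m
    (F G : seq I -> R) :
  (forall s, size s = m -> F s <= G s) -> msum r m F <= msum r m G.
Proof.
elim: m F G => [|m IH] F G FG /=; first exact: FG.
by apply: ler_sum => a _; apply: IH => s sm; apply: FG; rewrite /= sm.
Qed.

Lemma msum_ge0 {R : numDomainType} {I : Type} (r : seq I) m (F : seq I -> R) :
  (forall s, 0 <= F s) -> 0 <= msum r m F.
Proof.
elim: m F => [|m IH] F F0 //=.
by apply: sumr_ge0 => a _; exact: IH.
Qed.

Lemma ler_norm_msum {R : numDomainType} {I : Type} (r : seq I) m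
    (F : seq I -> R) :
  `|msum r m F| <= msum r m (fun s => `|F s|).
Proof.
elim: m F => [|m IH] F //=; apply: le_trans (ler_norm_sum _ _ _) _.
by apply: ler_sum => a _; exact: IH.
Qed.

Lemma le_msum_filter {R : numDomainType} {I : Type} (p : pred I) (r : seq I)
    m (F : seq I -> R) :
  (forall s, 0 <= F s) -> msum [seq a <- r | p a] m F <= msum r m F.
Proof.
elim: m F => [|m IH] F F0 //=; rewrite big_filter.
apply: (@le_trans _ _ (\sum_(a <- r | p a) msum r m (fun s => F (a :: s)))).
  by apply: ler_sum => a _; exact: IH.
rewrite [leRHS](bigID p) /= lerDl; apply: sumr_ge0 => a _.
exact: msum_ge0.
Qed.

(* Induction on [m]: the first entry is compared with the minimum of the
   others and, if larger, exchanged with it; each step costs a factor 2. *)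
Lemma msum_split_min {R : numDomainType} (r : seq nat) m (F : seq nat -> R) :
  (forall s, 0 <= F s) -> (forall s t, perm_eq s t -> F s = F t) ->
  msum r m.+1 F <=
    2 ^+ m * \sum_(a <- r) msum [seq b <- r | (a <= b)%N] m (fun s => F (a :: s)).
Proof.
elim: m F => [|m IH] F F0 Fsym; first by rewrite expr0 mul1r.
pose U a b := msum [seq c <- r | (a <= c)%N] m (fun s => F [:: a, b & s]).
have U0 a b : 0 <= U a b by exact: msum_ge0.
(* The first argument of [U] is the smaller leading entry. Exchanging the two sums shows that both
   halves are equal, whence the factor 2. *)
apply: (@le_trans _ _ (\sum_(b <- r) 2 ^+ m * \sum_(a <- r)
    ((a <= b)%N%:R * U a b + (b <= a)%N%:R * U b a))).
  rewrite [leLHS]/=; apply: ler_sum => b _.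
  apply: le_trans (IH (fun s => F (b :: s)) _ _) _ => //.
    by move=> s t st; apply: Fsym; rewrite perm_cons.
  rewrite ler_pM2l ?exprn_gt0 //; apply: ler_sum => a _.
  have [ab|/ltnW ba] := leqP a b.
    rewrite mul1r -[leLHS]addr0; apply: lerD; last by rewrite mulr_ge0.
    rewrite le_eqVlt; apply/orP; left; apply/eqP/eq_msum => s _; apply: Fsym.
    by rewrite (perm_catCA [:: b] [:: a] s).
  rewrite ba mul1r -[leLHS]add0r; apply: lerD; first by rewrite mulr_ge0.
  have -> : [seq c <- r | (a <= c)%N] =
      [seq c <- [seq c <- r | (b <= c)%N] | (a <= c)%N].
    rewrite -filter_predI; apply: eq_filter => c /=.
    by case: leqP => // ac; rewrite (leq_trans ba ac).
  exact: le_msum_filter.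
rewrite -mulr_sumr exprS [2 * _]mulrC -mulrA ler_pM2l ?exprn_gt0 //.
under eq_bigr do rewrite big_split.
rewrite big_split /= exchange_big /=.
rewrite mulr_natl mulr2n.
have E : \sum_(a <- r) \sum_(b <- r) (a <= b)%N%:R * U a b =
    \sum_(a <- r) msum [seq b <- r | (a <= b)%N] m.+1 (fun s => F (a :: s)).
  apply: eq_bigr => a _ /=; rewrite big_filter [RHS]big_mkcond /=.
  by apply: eq_bigr => b _; case: ifP; rewrite ?mul1r ?mul0r.
by rewrite E.
Qed.

(** * Lists of times described by their gaps *)

(* [s] lists the gaps between consecutive times, the first time being 0. *)
Fixpoint times (s : seq nat) : seq nat :=
  if s is a :: s' then 0%N :: map (addn a) (times s') else [:: 0%N].

Lemma size_times s : size (times s) = (size s).+1.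
Proof. by elim: s => //= a s IH; rewrite size_map IH. Qed.

(** The times after a gap form a shifted copy of the times of the remaining gaps, the form in which
    stationarity applies. *)
Lemma times_cat s b t :
  times (s ++ b :: t) = times s ++ map (addn (sumn s + b)) (times t).
Proof.
elim: s => [|a s IH] /=; first by rewrite add0n.
rewrite IH map_cat -map_comp; congr (_ :: _ ++ _).
by apply: eq_map => k /=; rewrite !addnA.
Qed.

Lemma nth_times s k : (k <= size s)%N -> nth 0%N (times s) k = sumn (take k s).
Proof.
elim: s k => [|a s IH] [|k] //= ks.
by rewrite (nth_map 0%N) ?IH // size_times.
Qed.

Lemma filter_geq_iota a n :
  [seq b <- iota 0 n | (a <= b)%N] = [seq b <- iota a n | (b < n)%N].
Proof.
have srt p m k : sorted ltn [seq b <- iota m k | p b].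
  by rewrite sorted_filter ?iota_ltn_sorted //; exact: ltn_trans.
apply: (irr_sorted_eq ltn_trans ltnn) => // b.
rewrite !mem_filter !mem_iota add0n leq0n /=.
by case: (leqP a b) => //= ab; case: ltnP => //= bn; rewrite ltn_addl.
Qed.

(** By symmetry of [F] the smallest entry may come first ([msum_split_min]); the others are
    rewritten as offsets from it and the argument repeats on them. The cost is a constant depending
    on [m] alone. *)
Lemma msum_times {R : numDomainType} m : exists2 c : R, 0 <= c &
  forall n (F : seq nat -> R),
  (forall s, 0 <= F s) -> (forall s t, perm_eq s t -> F s = F t) ->
  msum (iota 0 n) m.+1 F <=
    c * \sum_(h <- iota 0 n)
          msum (iota 0 n) m (fun s => F (map (addn h) (times s))).
Proof.
elim: m => [|m [c c0 IH]].
  exists 1 => // n F F0 Fsym; rewrite mul1r /=.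
  by apply: ler_sum => h _; rewrite addn0.
exists (2 ^+ m.+1 * c); first by rewrite mulr_ge0 ?exprn_ge0.
move=> n F F0 Fsym; apply: le_trans (msum_split_min _ _ _ F0 Fsym) _.
rewrite -mulrA ler_pM2l ?exprn_gt0 // mulr_sumr; apply: ler_sum => a _.
(* Dropping the condition [b < n] only adds nonnegative terms; the offsets from [a] then range
   freely over [iota 0 n]. *)
rewrite filter_geq_iota; apply: le_trans (le_msum_filter _ _ _ _ _) _ => //.
rewrite -[a in iota a n]addn0 iotaDl msum_map.
apply: le_trans (IH n (fun s => F (a :: map (addn a) s)) _ _) _ => //.
  by move=> s t st; apply: Fsym; rewrite perm_cons perm_map.
rewrite ler_wpM2l // [leRHS]/=; apply: ler_sum => b _; apply: le_msum => s _.
by rewrite /= addn0.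
Qed.

(** * Geometric decay and logarithms *)

Lemma geom_sum_le {R : realFieldType} (rho : R) n : 0 <= rho -> rho < 1 ->
  \sum_(k <- iota 0 n) rho ^+ k <= (1 - rho)^-1.
Proof.
move=> rho0 rho1; have h : 0 < 1 - rho by rewrite subr_gt0.
rewrite -(ler_pM2r h) mulVf ?gt_eqF // -[n in iota 0 n]subn0.
rewrite [X in X * _](_ : _ = \sum_(0 <= k < n) rho ^+ k) // big_mkord.
rewrite mulrC -[1 - rho]opprB mulNr -subrX1 opprB.
by rewrite gerBl exprn_ge0.
Qed.

(** Half of the decay absorbs one factor [k.+1]: $(k+1)\rho^{k/2}\le\sum_{i\le k}\rho^{i/2}$, a
    bounded geometric sum. The other half is left to the induction. *)
Lemma poly_exp_bounded {R : realType} (rho : R) M : 0 < rho -> rho < 1 ->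
  exists2 A : R, 1 <= A & forall k, k.+1%:R ^+ M * rho ^+ k <= A.
Proof.
elim: M rho => [|M IH] rho rho0 rho1.
  exists 1 => // k; rewrite mul1r exprn_ile1 // ltW //.
have s0 : 0 < Num.sqrt rho by rewrite sqrtr_gt0.
have s1 : Num.sqrt rho < 1 by rewrite -[ltRHS]sqrtr1 ltr_sqrt.
have [A A1 hA] := IH _ s0 s1.
have h : 1 <= (1 - Num.sqrt rho)^-1.
  by rewrite -[leLHS]invr1 lef_pV2 ?posrE ?subr_gt0 // gerBl ltW.
exists (A * (1 - Num.sqrt rho)^-1).
  by rewrite mulr_ege1.
move=> k; have -> : rho ^+ k = Num.sqrt rho ^+ k * Num.sqrt rho ^+ k.
  by rewrite -expr2 -exprM mulnC exprM sqr_sqrtr // ltW.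
rewrite exprSr mulrACA; apply: ler_pM; rewrite ?mulr_ge0 ?exprn_ge0 ?sqrtr_ge0 //.
apply: le_trans (geom_sum_le _ k.+1 (ltW s0) s1).
rewrite -[k.+1 in leLHS](size_iota 0) -sum1_size natr_sum mulr_suml.
rewrite [leLHS]big_seq [leRHS]big_seq.
apply: ler_sum => i; rewrite mem_iota ltnS => /andP[_ ik].
by rewrite mul1r; apply: ler_wiXn2l => //; exact: ltW.
Qed.

(** The logarithm enters here: about [ln W / - ln rho] terms are bounded by 1, and the later ones by
    a geometric series. *)
Lemma sum_min_geom {R : realType} (rho : R) : 0 < rho -> rho < 1 ->
  exists2 K : R, 0 <= K & forall W n, 1 <= W ->
  \sum_(k <- iota 0 n) Num.min 1 (W * rho ^+ k) <= K * (1 + ln W).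
Proof.
move=> rho0 rho1; set c := - ln rho.
have c0 : 0 < c by rewrite oppr_gt0 ln_lt0 // rho0.
have g0 : 0 <= (1 - rho)^-1 by rewrite invr_ge0 subr_ge0 ltW.
exists (c^-1 + 1 + (1 - rho)^-1).
  by rewrite !addr_ge0 // ?invr_ge0 ltW.
move=> W n W1; have W0 : 0 < W by exact: lt_le_trans W1.
have lW0 : 0 <= ln W by rewrite ln_ge0.
(* [N] exceeds [ln W / c], so that [W * rho ^+ N <= 1] and the terms from [N] on are at most the
   powers of [rho]. *)
set N := (Num.truncn (ln W / c)).+1.
have Nle : N%:R <= ln W / c + 1.
  by rewrite /N -natr1 lerD2r truncn_le // divr_ge0 // ltW.
have WN : W * rho ^+ N <= 1.
  rewrite -[W]lnK ?posrE // -[rho]lnK ?posrE // -expRM_natl -expRD expR_le1.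
  rewrite -[ln rho]opprK -/c mulrN subr_le0 -ler_pdivrMr //.
  by rewrite ltW // truncnS_gt.
have min0 k : 0 <= Num.min 1 (W * rho ^+ k).
  by rewrite le_min ler01 mulr_ge0 ?exprn_ge0 // ltW.
apply: (@le_trans _ _ (\sum_(k <- iota 0 (N + n)) Num.min 1 (W * rho ^+ k))).
  by rewrite addnC iotaD big_cat /= lerDl sumr_ge0.
rewrite iotaD big_cat /= add0n -[in X in _ + X <= _](addn0 N) (iotaDl N 0 n) big_map.
apply: (@le_trans _ _ (N%:R + (1 - rho)^-1)).
  apply: lerD.
    rewrite -[N in leRHS](size_iota 0) -sum1_size natr_sum.
    by apply: ler_sum => k _; rewrite ge_min lexx.
  apply: le_trans (geom_sum_le _ n (ltW rho0) rho1); apply: ler_sum => k _.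
  rewrite ge_min; apply/orP; right.
  by rewrite exprD mulrA ler_piMl // exprn_ge0 // ltW.
have h1 : N%:R <= (c^-1 + 1) * (1 + ln W).
  apply: le_trans Nle _; rewrite mulrDl mul1r [ln W / c]mulrC.
  by apply: lerD; [rewrite ler_pM2l ?invr_gt0 // lerDr|rewrite lerDl].
rewrite mulrDl lerD // ler_peMr //.
by rewrite lerDl.
Qed.

(* The decay is governed by the largest entry of [s]; a product over all the
   entries has a sum over [s] that factorises.  With [rho ^+ p.+1 = theta] the
   product uses up [rho ^+ (p * b)] and the remaining [rho ^+ b] absorbs the
   polynomial in [b]. *)
Lemma min_prod_bound {R : realType} (theta C : R) (p l M : nat) :
  0 < theta -> theta < 1 -> 0 <= C -> (0 < p)%N ->
  exists rho A : R, [/\ 0 < rho, rho < 1, 1 <= A &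
    forall (s : seq nat) (b : nat) (t a u x : R), size s = p ->
      (forall k, k \in s -> (k <= b)%N) ->
      0 <= a -> a <= t -> 1 <= t -> 0 <= u ->
      x <= 2 * u -> x <= C * u * a ^+ l * b.+1%:R ^+ M * theta ^+ b ->
      x <= 2 * u * \prod_(k <- s) Num.min 1 (A * t ^+ l * rho ^+ k)].
Proof.
move=> th0 th1 C0 p0; pose rho := expR (ln theta / p.+1%:R).
have rho0 : 0 < rho by exact: expR_gt0.
have rho1 : rho < 1 by rewrite expR_lt1 pmulr_llt0 ?invr_gt0 // ln_lt0 ?th0.
have thE : theta = rho ^+ p.+1.
  by rewrite -expRM_natl mulrC divfK ?lnK // pnatr_eq0.
have [A0 A01 hA0] := poly_exp_bounded rho M rho0 rho1.
have A00 : 0 <= A0 by apply: le_trans A01.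
exists rho, (1 + C * A0); split => //; first by rewrite lerDl mulr_ge0.
move=> s b t a u x sp sb a0 at_ t1 u0 x1 x2; set A := 1 + C * A0.
have A1 : 1 <= A by rewrite lerDl mulr_ge0.
have [W WE] : {W | W = A * t ^+ l} by exists (A * t ^+ l).
rewrite -WE.
have W1 : 1 <= W by rewrite WE mulr_ege1 // exprn_ege1.
have W0 : 0 <= W by apply: le_trans W1.
have rk k : (k <= b)%N -> rho ^+ b <= rho ^+ k.
  by move=> kb; apply: ler_wiXn2l => //; exact: ltW.
(* If [1 <= W * rho ^+ b], every minimum equals 1 since [k <= b], and the bound [2 * u] suffices.
   Otherwise each factor is at least [W * rho ^+ b] and the decaying bound is used. *)
have [Wb|Wb] := leP 1 (W * rho ^+ b).
  rewrite big_seq big1 ?mulr1 // => k /sb /rk kb.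
  by apply/min_idPl; apply: le_trans Wb _; rewrite ler_wpM2l.
have Wb0 : 0 <= W * rho ^+ b by rewrite mulr_ge0 ?exprn_ge0 // ltW.
have h : (W * rho ^+ b) ^+ p <= \prod_(k <- s) Num.min 1 (W * rho ^+ k).
  apply: (@le_trans _ _ (\prod_(k < size s) (W * rho ^+ b))).
    by rewrite prodr_const card_ord sp.
  rewrite big_tnth; apply: ler_prod => i _; rewrite Wb0 le_min ltW //= ler_wpM2l // rk //.
  by apply: sb; exact: mem_tnth.
apply: le_trans x2 _; apply: (@le_trans _ _ (u * (W * rho ^+ b) ^+ p)); last first.
  rewrite [2 * u]mulrC -[u * 2 * _]mulrA ler_wpM2l //; apply: le_trans h _.
  rewrite ler_peMl ?ler1n //; apply: prodr_ge0 => k _.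
  by rewrite le_min ler01 mulr_ge0 ?exprn_ge0 // ltW.
rewrite [C * u]mulrC -!mulrA ler_wpM2l // exprMn.
have -> : theta ^+ b = rho ^+ b * (rho ^+ b) ^+ p.
  by rewrite -exprS thE -!exprM mulnC.
rewrite !mulrA ler_wpM2r ?exprn_ge0 ?(ltW rho0) //.
(* Here [0 < p] and [1 <= W] give [W <= W ^+ p]; the constant, [a ^+ l] and the polynomial factor
   fit into a single [W]. *)
apply: (@le_trans _ _ W); last by apply: ler_eXnr.
rewrite WE -!mulrA.
apply: (@le_trans _ _ (C * (t ^+ l * A0))).
  rewrite ler_wpM2l //; apply: ler_pM; rewrite ?hA0 ?exprn_ge0 //.
    by rewrite mulr_ge0 ?exprn_ge0 ?(ltW rho0).
  by rewrite lerXn2r ?nnegrE // (le_trans a0).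
rewrite mulrCA mulrC ler_wpM2r ?exprn_ge0 ?(le_trans a0) //.
by rewrite lerDr.
Qed.

(** * The shape of the moment bound and its recursion *)

(** The common right-hand side of both estimates, with [x] for $n\|\varphi(X_0)\|_r$: [m./2] is $p$
    for $m=2p$ and for $m=2p+1$. *)
Definition moment_bound {R : pzSemiRingType} (x L : R) (m : nat) : R :=
  \sum_(1 <= i < m./2.+1) x ^+ i * L ^+ (m - i).

Lemma moment_bound_ge0 {R : numDomainType} (x L : R) m :
  0 <= x -> 0 <= L -> 0 <= moment_bound x L m.
Proof.
by move=> x0 L0; apply: sumr_ge0 => i _; rewrite mulr_ge0 ?exprn_ge0.
Qed.

Lemma le_moment_bound {R : numDomainType} (x L : R) m i :
  0 <= x -> 0 <= L -> (0 < i <= m./2)%N ->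
  x ^+ i * L ^+ (m - i) <= moment_bound x L m.
Proof.
move=> x0 L0 im; rewrite /moment_bound (bigD1_seq i) ?mem_index_iota ?iota_uniq //=.
by rewrite lerDl sumr_ge0 // => k _; rewrite mulr_ge0 ?exprn_ge0.
Qed.

(** The terms of index [i] and [j] multiply to the term of index [i + j], still in range because
    [a./2 + b./2 <= (a + b)./2]; the constant counts the pairs. *)
Lemma moment_boundM {R : numDomainType} (x L : R) a b :
  0 <= x -> 0 <= L ->
  moment_bound x L a * moment_bound x L b
    <= (a./2 * b./2)%:R * moment_bound x L (a + b).
Proof.
move=> x0 L0; rewrite natrM -mulrA {1}/moment_bound mulr_suml.
have sumc c m (F : nat -> R) : (forall i, (0 < i <= m)%N -> F i <= c) ->
    \sum_(1 <= i < m.+1) F i <= m%:R * c.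
  move=> Fc; rewrite big_add1 big_mkord /=.
  apply: (@le_trans _ _ (\sum_(i < m) c)).
    by apply: ler_sum => i _; apply: Fc; rewrite /= ltn_ord.
  by rewrite sumr_const card_ord mulr_natl.
apply: (sumc) => i /andP[i0 ia]; rewrite {1}/moment_bound mulr_sumr.
apply: (sumc) => j /andP[j0 jb].
have ia' : (i <= a)%N by rewrite (leq_trans ia) // -divn2 leq_div.
have jb' : (j <= b)%N by rewrite (leq_trans jb) // -divn2 leq_div.
rewrite mulrACA -!exprD.
have -> : (a - i + (b - j) = a + b - (i + j))%N by rewrite subnDA -addnBAC // addnBA.
apply: le_moment_bound => //; rewrite addn_gt0 i0 /=.
apply: leq_trans (leq_add ia jb) _.
by rewrite halfD leq_addl.
Qed.

(** [a j p] stands for a moment of order [p.+1], whence the shifts: the orders [q.+1] and [p - q] of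
    a product add up to [p.+1]. The index [j] will carry $n$ and $\varphi$, so that [K] is uniform
    in them. *)
Lemma moment_recursion {R : realFieldType} {J : Type} (a : J -> nat -> R)
    (x L : J -> R) :
  (forall j, 0 <= x j) -> (forall j, 0 <= L j) ->
  (forall j p, 0 <= a j p) -> (forall j, a j 0%N = 0) ->
  (forall p, (0 < p)%N -> exists K : R, forall j,
     a j p <= K * (x j * L j ^+ p) + \sum_(q < p) a j q * a j (p - q.+1)%N) ->
  forall p, exists2 K : R, 0 <= K &
    forall j, a j p <= K * moment_bound (x j) (L j) p.+1.
Proof.
move=> x0 L0 a0 aj0 rec.
suff H p : exists2 K : R, 0 <= K & forall q, (q <= p)%N ->
    forall j, a j q <= K * moment_bound (x j) (L j) q.+1.
  by move=> p; have [K K0 hK] := H p; exists K => // j; exact: hK.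
elim: p => [|p [K K0 hK]].
  (* At order 1 [moment_bound] is an empty sum, so this case rests on [a j 0 = 0]. *)
  exists 0 => // q; rewrite leqn0 => /eqP -> j.
  by rewrite aj0 mul0r.
have [Kp hKp] := rec p.+1 isT.
pose K1 := `|Kp| + \sum_(q < p.+1) K * K * (q.+1./2 * (p - q).+1./2)%:R.
have K10 : 0 <= K1.
  by rewrite addr_ge0 // sumr_ge0 // => q _; rewrite !mulr_ge0.
exists (K + K1); first exact: addr_ge0.
move=> q; rewrite leq_eqVlt => /orP[/eqP -> j|/hK h j]; last first.
  apply: le_trans (h j) _; rewrite ler_wpM2r ?moment_bound_ge0 //.
  by rewrite lerDl.
have D0 m := moment_bound_ge0 (x j) (L j) m (x0 j) (L0 j).
apply: (@le_trans _ _ (K1 * moment_bound (x j) (L j) p.+2)); last first.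
  by rewrite ler_wpM2r // lerDr.
apply: le_trans (hKp j) _; rewrite mulrDl lerD //.
  apply: (@le_trans _ _ (`|Kp| * (x j * L j ^+ p.+1))).
    by rewrite ler_wpM2r ?mulr_ge0 ?exprn_ge0 ?ler_norm.
  rewrite ler_wpM2l //.
  by have := le_moment_bound (x j) (L j) p.+2 1 (x0 j) (L0 j) isT; rewrite subn1.
rewrite mulr_suml; apply: ler_sum => -[i /= ip] _.
rewrite subSS.
apply: (@le_trans _ _ ((K * moment_bound (x j) (L j) i.+1) *
   (K * moment_bound (x j) (L j) (p - i).+1))).
  by apply: ler_pM; rewrite ?a0 //; apply: hK; rewrite ?leq_subr.
rewrite mulrACA -[K * K * _ * _]mulrA ler_wpM2l ?mulr_ge0 //.
apply: le_trans (moment_boundM _ _ _ _ (x0 j) (L0 j)) _.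
by rewrite addSn addnS subnKC.
Qed.

Lemma sumr_const_seq {R : pzSemiRingType} {I : Type} (r : seq I) (c : R) :
  \sum_(i <- r) c = (size r)%:R * c.
Proof. by rewrite mulr_natl -[size r]card_ord -sumr_const big_tnth. Qed.

(** The entry at position [q] occurs in neither [take q s] nor [drop q.+1 s]; summing over it gives
    the factor [size r]. *)
Lemma msum_take_drop {R : comPzSemiRingType} {I : Type} (r : seq I) (q p : nat)
    (F G : seq I -> R) :
  msum r (q + p.+1) (fun s => F (take q s) * G (drop q.+1 s)) =
    (size r)%:R * (msum r q F * msum r p G).
Proof.
elim: q F => [|q IH] F.
  rewrite /= -sumr_const_seq; apply: eq_bigr => a _; rewrite -msumZ.
  by apply: eq_msum => s _; rewrite drop0.
rewrite /= mulr_suml mulr_sumr; apply: eq_bigr => a _.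
by rewrite -(IH (fun s => F (a :: s))).
Qed.

(** * Expectations, norms and stationarity *)

Lemma expectation_bigsum {R : realType} {disp : measure_display}
    {Omega : measurableType disp} (P : probability Omega R) {I : Type}
    (r : seq I) (F : I -> Omega -> R) :
  (forall i, F i \in Lfun P 1) ->
  (fun w => \sum_(i <- r) F i w) \in Lfun P 1 /\
  ('E_P[fun w => (\sum_(i <- r) F i w)%R] = (\sum_(i <- r) fine 'E_P[F i])%:E)%E.
Proof.
move=> LF; have sumE (s : seq I) : (fun w => \sum_(i <- s) F i w) = \sum_(i <- s) F i.
  by apply/funext => w; rewrite fct_sumE.
split; first by rewrite sumE rpred_sum.
elim: r => [|i r IH].
  by under eq_fun do rewrite big_nil; rewrite big_nil expectation_cst.
under eq_fun do rewrite big_cons.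
rewrite big_cons EFinD -IH fineK ?expectation_fin_num // -expectationD //.
by rewrite sumE rpred_sum.
Qed.

Lemma expectation_msum {R : realType} {disp : measure_display}
    {Omega : measurableType disp} (P : probability Omega R) {I : Type}
    (r : seq I) m (F : seq I -> Omega -> R) :
  (forall s, F s \in Lfun P 1) ->
  (fun w => msum r m (fun s => F s w)) \in Lfun P 1 /\
  ('E_P[fun w => msum r m (fun s => F s w)] =
     (msum r m (fun s => fine 'E_P[F s]))%:E)%E.
Proof.
elim: m F => [|m IH] F LF /=; first by rewrite fineK ?expectation_fin_num.
have [h ->] := expectation_bigsum P r
  (fun a w => msum r m (fun s => F (a :: s) w))
  (fun a => (IH (fun s => F (a :: s)) (fun s => LF (a :: s))).1).
split => //; congr EFin; apply: eq_bigr => a _.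
by have [_ ->] := IH (fun s => F (a :: s)) (fun s => LF (a :: s)).
Qed.

Lemma bounded_Lfun1 {R : realType} {disp : measure_display}
    {Omega : measurableType disp} (P : probability Omega R) (Y : Omega -> R) c :
  measurable_fun [set: Omega] Y -> (forall w, `|Y w| <= c) -> Y \in Lfun P 1.
Proof.
move=> mY Yc; apply/Lfun1_integrable.
apply: measurable_bounded_integrable => //.
  by rewrite fin_num_fun_lty //; exact: fin_num_measure.
exists c; split; first exact: num_real.
by move=> x cx w _ /=; apply: le_trans (Yc w) (ltW cx).
Qed.

(** Hoelder's inequality against the constant 1 on a probability space. *)
Lemma mean_abs_le_rv_norm {R : realType} {disp : measure_display}
    {Omega : measurableType disp} (P : probability Omega R) (Y : Omega -> R) r :
  measurable_fun [set: Omega] Y -> (forall w, `|Y w| <= 1) -> 1 <= r ->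
  (\int[P]_w `|(Y w)%:E| <= (rv_norm P r Y)%:E)%E.
Proof.
move=> mY Y1 r1; have r0 : 0 < r by exact: lt_le_trans r1.
(* [rv_norm] takes [fine], which sends an infinite norm to 0, so finiteness comes first. *)
have Nfin : (Lnorm P r%:E (EFin \o Y) < +oo)%E.
  rewrite unlock poweR_lty //.
  apply: (@le_lt_trans _ _ (\int[P]_x (cst 1 x))%E); last first.
    by rewrite integral_cst //= mul1e probability_setT ltry.
  apply: ge0_le_integral => //.
  - by move=> w _; rewrite poweR_ge0.
  - apply/measurable_EFinP; apply: (measurableT_comp (measurable_powR _)).
    exact: measurableT_comp.
  - move=> w _ /=; rewrite lee_fin (_ : 1 = 1 `^ r); last by rewrite powR1.
    by apply: ge0_ler_powR; rewrite ?nnegrE // ltW.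
rewrite /rv_norm fineK; last by rewrite ge0_fin_numE ?Lnorm_ge0.
rewrite -(Lnorm1 P (EFin \o Y)).
(* At [r = 1] the conjugate exponent [(1 - r^-1)^-1] would be 0, while [hoelder] wants it
   positive. *)
have [<-|r_neq1] := eqVneq 1 r; first by [].
have r_gt1 : 1 < r by rewrite lt_neqAle r_neq1.
have q0 : 0 < 1 - r^-1 by rewrite subr_gt0 invf_lt1.
have := @hoelder _ _ _ P Y (cst 1) r (1 - r^-1)^-1 mY (measurable_cst _) r0.
rewrite invr_gt0 invrK subrKC => /(_ q0 erefl).
rewrite Lnorm_cst1 [X in (_ * X `^ _)%E](_ : _ = 1%E); last first.
  exact: probability_setT.
rewrite poweR1r mule1; congr (_ <= _)%E; apply: eq_Lnorm => w /=.
by rewrite mulr1.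
Qed.

Lemma norm_prod_comp_le1 {R : realType} {disp : measure_display}
    {Omega : measurableType disp} (P : probability Omega R) {d : nat}
    (X : nat -> {RV P >-> d.-tuple R}) (phi : d.-tuple R -> R) (t : seq nat) w :
  (forall x, `|phi x| <= 1) -> `|\prod_(k <- t) phi (X k w)| <= 1.
Proof.
move=> phi1; rewrite normr_prod; apply: prodr_ile1 => k _.
by rewrite normr_ge0 phi1.
Qed.

Lemma measurable_prod_comp {R : realType} {disp disp' : measure_display}
    {Omega : measurableType disp} {E : measurableType disp'}
    (X : nat -> Omega -> E) (phi : E -> R) (t : seq nat) :
  (forall k, measurable_fun [set: Omega] (X k)) ->
  measurable_fun [set: E] phi ->
  measurable_fun [set: Omega] (fun w => \prod_(k <- t) phi (X k w)).
Proof.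
move=> mX mphi; elim: t => [|k t IH].
  by under eq_fun do rewrite big_nil; exact: measurable_cst.
under eq_fun do rewrite big_cons; apply: measurable_funM => //.
exact: measurableT_comp.
Qed.

(** The product is a function [G] of the states up to the largest time in [t]. Stationarity equates
    the laws of this vector and of its shift, and both means are integrals of [G] against these
    laws. *)
Lemma stationary_mean_prod {R : realType} {disp : measure_display}
    {Omega : measurableType disp} (P : probability Omega R) {d : nat}
    (X : nat -> {RV P >-> d.-tuple R}) (phi : d.-tuple R -> R) (h : nat)
    (t : seq nat) :
  stationary P X -> measurable_fun [set: d.-tuple R] phi ->
  (forall x, `|phi x| <= 1) ->
  ('E_P[fun w => (\prod_(k <- map (addn h) t) phi (X k w))%R] =
   'E_P[fun w => (\prod_(k <- t) phi (X k w))%R])%E.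
Proof.
move=> statX mphi phi1; set m := (\max_(k <- t) k)%N.
pose G (v : m.+1.-tuple (d.-tuple R)) := \prod_(k <- t) phi (tnth v (inord k)).
pose Z g w := [tuple X (g + j)%N w | j < m.+1].
have mZ g : measurable_fun [set: Omega] (Z g).
  apply/measurable_fun_tnthP => i; rewrite /Z.
  rewrite (_ : _ \o _ = X (g + i)%N) //.
  by apply/funext => w /=; rewrite tnth_mktuple.
have mG : measurable_fun [set: _] G.
  apply: (@measurable_prod_comp _ _ _ _ _ (fun k v => tnth v (inord k))) => // k.
  exact: measurable_tnth.
have tm k : k \in t -> (inord k : 'I_m.+1) = k :> nat.
  move=> kt; rewrite inordK // ltnS.
  exact: (@leq_bigmax_seq _ t xpredT (fun i => i) k).
have GZ g w : \prod_(k <- map (addn g) t) phi (X k w) = G (Z g w).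
  rewrite big_map /G big_seq [RHS]big_seq; apply: eq_bigr => k kt.
  by rewrite tnth_mktuple tm.
have iG g : P.-integrable (Z g @^-1` [set: _]) ((EFin \o G) \o Z g).
  rewrite preimage_setT; apply/Lfun1_integrable; apply: (@bounded_Lfun1 _ _ _ _ _ 1).
    exact: measurableT_comp.
  move=> w; rewrite -GZ; exact: norm_prod_comp_le1.
have EZ g : ('E_P[fun w => (\prod_(k <- map (addn g) t) phi (X k w))%R] =
    \int[pushforward P (Z g)]_v (G v)%:E)%E.
  rewrite unlock integral_pushforward //; last exact/measurable_EFinP.
  by rewrite preimage_setT; apply: eq_integral => w _; rewrite GZ.
have -> : t = map (addn 0) t by rewrite map_id_in.
rewrite -map_comp (eq_map (g := addn h)) // !EZ.
apply: eq_measure_integral => A mA _.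
exact: statX.
Qed.

(** * From the indices of the mixing property to lists of times *)

(** Each monomial is at most the absolute value of its coefficient times a power of [x]; as
    [1 <= x], adding the degrees gives a common exponent. *)
Lemma meval_bound {R : realFieldType} (p : nat) (Q : mpoly.mpoly p R) :
  exists (K : R) (M : nat), 0 <= K /\ forall (v : 'I_p -> R) (x : R), 1 <= x ->
    (forall j, 0 <= v j <= x) -> mpoly.meval v Q <= K * x ^+ M.
Proof.
suff [K [M [K0 H]]] : exists (K : R) (M : nat), 0 <= K /\
    forall (v : 'I_p -> R) (x : R), 1 <= x -> (forall j, 0 <= v j <= x) ->
    \sum_(m <- mpoly.msupp Q)
      mpoly.mcoeff m Q * \prod_(i < p) v i ^+ mpoly.fun_of_multinom m i
      <= K * x ^+ M.
  exists K, M; split => // v x x1 vx; rewrite mpoly.mevalE; exact: H.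
elim: (mpoly.msupp Q : seq _) => [|m S [K [M [K0 IH]]]].
  by exists 0, 0%N; split => // v x _ _; rewrite big_nil mul0r.
pose D := (\sum_(i < p) mpoly.fun_of_multinom m i)%N.
exists (`|mpoly.mcoeff m Q| + K), (D + M)%N.
split=> [|v x x1 vx]; first exact: addr_ge0.
have x0 : 0 <= x by exact: le_trans x1.
rewrite big_cons mulrDl lerD //; last first.
  apply: le_trans (IH v x x1 vx) _; rewrite ler_wpM2l //.
  by rewrite ler_weXn2l // leq_addl.
apply: (@le_trans _ _ (`|mpoly.mcoeff m Q| *
    \prod_(i < p) v i ^+ mpoly.fun_of_multinom m i)).
  rewrite ler_wpM2r ?ler_norm // prodr_ge0 // => i _.
  by have /andP[v0 _] := vx i; exact: exprn_ge0.
rewrite ler_wpM2l //; apply: (@le_trans _ _ (x ^+ D)).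
  rewrite /D -prodrXr; apply: ler_prod => i _.
  have /andP[v0 vx'] := vx i.
  by rewrite exprn_ge0 //= lerXn2r ?nnegrE // (le_trans v0).
by rewrite ler_weXn2l // leq_addr.
Qed.

(** With [prod_ord_drop], turns the covariance factors of [multiple_mixing], indexed by ordinals,
    into products over the times before and after the cut. *)
Lemma prod_ord_take {R : comPzSemiRingType} (g : nat -> R) (t1 t2 : seq nat)
    n q :
  size (t1 ++ t2) = n -> size t1 = q.+1 ->
  \prod_(k < n | (k <= q)%N) g (nth 0%N (t1 ++ t2) k) = \prod_(k <- t1) g k.
Proof.
move=> sn s1; rewrite (big_nth 0%N) big_mkord s1.
rewrite (big_ord_widen_cond n xpredT (fun i => g (nth 0%N t1 i))); last first.
  by rewrite -sn -s1 size_cat leq_addr.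
by apply: eq_bigr => i iq; rewrite nth_cat s1 ltnS iq.
Qed.

Lemma prod_ord_drop {R : comPzSemiRingType} (g : nat -> R) (t1 t2 : seq nat)
    n q :
  size (t1 ++ t2) = n -> size t1 = q.+1 ->
  \prod_(k < n | (q < k)%N) g (nth 0%N (t1 ++ t2) k) = \prod_(k <- t2) g k.
Proof.
move=> sn s1.
transitivity (\prod_(q.+1 <= k < n) g (nth 0%N (t1 ++ t2) k)).
  by rewrite big_geq_mkord.
rewrite [RHS](big_nth 0%N) -{1}[q.+1]add0n big_addn.
have -> : (n - q.+1 = size t2)%N by rewrite -sn size_cat s1 addKn.
apply: eq_big_nat => i _.
by rewrite nth_cat s1 ltnNge leq_addl /= addnK.
Qed.

Lemma partial_index_nth (s : seq nat) p k : size s = p -> (k <= p)%N ->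
  partial_index (fun j : 'I_p => nth 0%N s j) k = sumn (take k s).
Proof.
move=> sp kp; rewrite /partial_index sumnE (big_nth 0%N) big_mkord.
rewrite size_takel ?sp //.
rewrite (big_ord_widen_cond p xpredT (fun i => nth 0%N (take k s) i)) //.
by apply: eq_bigr => i ik; rewrite nth_take.
Qed.

(** * Means of products along the process *)

Definition prod_mean {R : realType} {disp : measure_display}
    {Omega : measurableType disp} (P : probability Omega R) {d : nat}
    (X : nat -> {RV P >-> d.-tuple R}) (phi : d.-tuple R -> R)
    (t : seq nat) : R :=
  fine 'E_P[fun w => (\prod_(k <- t) phi (X k w))%R]%E.

Section prod_mean.
Context {R : realType} {disp : measure_display} {Omega : measurableType disp}.
Context {P : probability Omega R} {d : nat}.
Context {X : nat -> {RV P >-> d.-tuple R}} {phi : d.-tuple R -> R}.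
Context (mphi : measurable_fun [set: d.-tuple R] phi).
Context (phi1 : forall x, `|phi x| <= 1).

Local Notation Y t := (fun w => \prod_(k <- t) phi (X k w)).
Local Notation e := (prod_mean P X phi).

Lemma measurable_prod_var t : measurable_fun [set: Omega] (Y t).
Proof. exact: (measurable_prod_comp X). Qed.

Lemma prod_Lfun1 t : Y t \in Lfun P 1.
Proof.
apply: (@bounded_Lfun1 _ _ _ _ _ 1) => [|w]; first exact: measurable_prod_var.
exact: norm_prod_comp_le1.
Qed.

Lemma prod_meanE t : ('E_P[Y t] = (e t)%:E)%E.
Proof. by rewrite fineK // expectation_fin_num // prod_Lfun1. Qed.

Lemma prod_mean_shift h t : stationary P X -> e (map (addn h) t) = e t.
Proof. by move=> statX; rewrite /prod_mean stationary_mean_prod. Qed.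

Lemma prod_mean_perm s t : perm_eq s t -> e s = e t.
Proof.
move=> st; rewrite /prod_mean; congr (fine (expectation _ _)).
by apply/funext => w; exact: perm_big.
Qed.

Lemma prod_mean_le_rv_norm r k t : 1 <= r ->
  `|e (k :: t)| <= rv_norm P r (phi \o X k).
Proof.
move=> r1; have mk : measurable_fun [set: Omega] (phi \o X k).
  exact: measurableT_comp.
rewrite -lee_fin -abse_EFin -prod_meanE unlock.
apply: le_trans (le_abse_integral _ _ _) _ => //.
  exact/measurable_EFinP/measurable_prod_var.
apply: le_trans (mean_abs_le_rv_norm _ _ _ mk (fun w => phi1 (X k w)) r1) => //.
apply: ge0_le_integral => //.
- by apply: measurableT_comp => //; exact/measurable_EFinP/measurable_prod_var.
- by apply: measurableT_comp => //; exact/measurable_EFinP.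
- move=> w _ /=; rewrite lee_fin big_cons normrM ler_piMr //.
  exact: norm_prod_comp_le1.
Qed.

Lemma prod_mean_le1 t : `|e t| <= 1.
Proof.
rewrite -lee_fin -abse_EFin -prod_meanE unlock.
apply: le_trans (le_abse_integral _ _ _) _ => //.
  exact/measurable_EFinP/measurable_prod_var.
apply: (@le_trans _ _ (\int[P]_x (cst 1 x))%E); last first.
  by rewrite integral_cst //= mul1e probability_setT.
apply: ge0_le_integral => //.
- by apply: measurableT_comp => //; exact/measurable_EFinP/measurable_prod_var.
- by move=> w _ /=; rewrite lee_fin; exact: norm_prod_comp_le1.
Qed.

Lemma covariance_prod t1 t2 :
  (covariance P (Y t1) (Y t2) = (e (t1 ++ t2) - e t1 * e t2)%:E)%E.
Proof.
have YM : Y t1 * Y t2 = Y (t1 ++ t2).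
  by apply/funext => w; rewrite big_cat.
rewrite covarianceE ?YM ?prod_Lfun1 // !prod_meanE.
by rewrite EFinB EFinM.
Qed.

End prod_mean.

(** * Cutting at the largest gap *)

(** The block after the cut is a shifted list of times, and stationarity removes the shift from its
    mean. The polynomial gives way to a power of [b.+1]; the successor keeps the base at least 1
    when all gaps vanish. *)
Lemma multiple_mixing_times {R : realType} {disp : measure_display}
    {Omega : measurableType disp} (P : probability Omega R) {d : nat}
    (X : nat -> {RV P >-> d.-tuple R})
    {B : completeNormedModType R} (ev : B -> d.-tuple R -> R) (theta r : R) :
  stationary P X -> (forall f, measurable_fun [set: d.-tuple R] (ev f)) ->
  multiple_mixing P X ev theta r ->
  forall p, (0 < p)%N -> exists (C : R) (l M : nat), 0 <= C /\
  forall (s : seq nat) (q b : nat) (f : B), size s = p -> (q < p)%N ->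
    (forall k, k \in s -> (k <= b)%N) ->
    ('E_P[ev f \o X 0%N] = 0)%E -> (forall x, `|ev f x| <= 1) ->
    `|prod_mean P X (ev f) (times s) -
      prod_mean P X (ev f) (times (take q s)) *
      prod_mean P X (ev f) (times (drop q.+1 s))|
    <= C * rv_norm P r (ev f \o X 0%N) * `|f| ^+ l * b.+1%:R ^+ M *
       theta ^+ nth 0%N s q.
Proof.
move=> statX mev [th0 th1 r1 mix] p p0.
have [C [l [Q [C0 CQ]]]] := mix p p0.
have [K [M [K0 hK]]] := meval_bound p Q.
exists (C * K), l, M; split; first by rewrite mulr_ge0 // ltW.
move=> s q b f sp qp sb Ef f1.
pose T1 := times (take q s).
pose T2 := map (addn (sumn (take q s) + nth 0%N s q)) (times (drop q.+1 s)).
have sE : s = take q s ++ nth 0%N s q :: drop q.+1 s.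
  by rewrite -drop_nth ?sp // cat_take_drop.
have tE : times s = T1 ++ T2 by rewrite {1}sE times_cat.
have sT1 : size T1 = q.+1 by rewrite size_times size_takel // sp ltnW.
have sT : size (T1 ++ T2) = p.+1 by rewrite -tE size_times sp.
have idx (k : 'I_p.+1) : partial_index (fun j : 'I_p => nth 0%N s j) k =
    nth 0%N (T1 ++ T2) k.
  by rewrite -tE nth_times ?sp -1?ltnS // partial_index_nth // -ltnS.
have := CQ (fun j => nth 0%N s j) (Ordinal qp) f Ef f1.
under eq_fun do under eq_bigr do rewrite idx.
under [X in covariance _ _ X]eq_fun do under eq_bigr do rewrite idx.
under eq_fun => w do rewrite (prod_ord_take (fun k => ev f (X k w)) _ _ _ _ sT sT1).
under [X in covariance _ _ X]eq_fun => w do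
  rewrite (prod_ord_drop (fun k => ev f (X k w)) _ _ _ _ sT sT1).
rewrite covariance_prod // abse_EFin lee_fin -tE prod_mean_shift // => h.
apply: le_trans h _ => /=.
rewrite ler_wpM2r ?exprn_ge0 ?(ltW th0) //.
have u0 : 0 <= rv_norm P r (ev f \o X 0%N) by rewrite fine_ge0 // Lnorm_ge0.
apply: (@le_trans _ _ (C * rv_norm P r (ev f \o X 0%N) * `|f| ^+ l *
    (K * b.+1%:R ^+ M))); last by rewrite le_eqVlt; apply/orP; left; apply/eqP; ring.
rewrite ler_wpM2l ?mulr_ge0 ?exprn_ge0 ?(ltW C0) //.
apply: hK => [|j]; first by rewrite ler1n.
by rewrite ler0n ler_nat ltnW // ltnS sb // mem_nth // sp.
Qed.

(** At the largest gap the covariance satisfies both bounds required by [min_prod_bound]. Summing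
    the products of means over every [q] frees the estimate from the position of that gap. *)
Lemma prod_mean_times_bound {R : realType} {disp : measure_display}
    {Omega : measurableType disp} (P : probability Omega R) {d : nat}
    (X : nat -> {RV P >-> d.-tuple R})
    {B : completeNormedModType R} (ev : B -> d.-tuple R -> R) (theta r : R) :
  stationary P X -> (forall f, measurable_fun [set: d.-tuple R] (ev f)) ->
  multiple_mixing P X ev theta r ->
  forall p, (0 < p)%N -> exists rho A : R, exists l : nat,
  [/\ 0 < rho, rho < 1, 1 <= A &
  forall (s : seq nat) (f : B), size s = p ->
    ('E_P[ev f \o X 0%N] = 0)%E -> (forall x, `|ev f x| <= 1) ->
    `|prod_mean P X (ev f) (times s)| <=
      2 * rv_norm P r (ev f \o X 0%N) *
        \prod_(k <- s) Num.min 1 (A * (`|f| + theta^-1) ^+ l * rho ^+ k) +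
      \sum_(q < p) `|prod_mean P X (ev f) (times (take q s))| *
                   `|prod_mean P X (ev f) (times (drop q.+1 s))|].
Proof.
move=> statX mev mixX p p0; have [th0 th1 r1 _] := mixX.
have [C [l [M [C0 HC]]]] := multiple_mixing_times P X ev theta r statX mev mixX p p0.
have [rho [A [rho0 rho1 A1 HA]]] := min_prod_bound theta C p l M th0 th1 C0 p0.
exists rho, A, l; split => // s f sp Ef f1.
set e := fun t => prod_mean P X (ev f) (times t).
set u := rv_norm P r (ev f \o X 0%N).
have [q qp qmax] : exists2 q, (q < p)%N & forall k, k \in s -> (k <= nth 0%N s q)%N.
  have s_gt0 : (0 < size s)%N by rewrite sp.
  have [i _ Hi] := @arg_maxnP _ (Ordinal s_gt0) xpredT (fun i => nth 0%N s i) isT.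
  exists i; first by rewrite -sp.
  move=> k ks; have ik : (index k s < size s)%N by rewrite index_mem.
  by have := Hi (Ordinal ik) isT; rewrite /= nth_index.
(* Every [times t] begins with 0, so the norm at time 0 bounds each of these means. *)
have eu t : `|e t| <= u by case: t => [|a t]; exact: prod_mean_le_rv_norm.
have e1 t : `|e t| <= 1 by exact: prod_mean_le1.
have u0 : 0 <= u by apply: le_trans (eu [::]).
have t1 : 1 <= `|f| + theta^-1.
  by rewrite -[leLHS]add0r lerD // -[leLHS]invr1 lef_pV2 ?posrE // ltW.
have cov : `|e s - e (take q s) * e (drop q.+1 s)| <=
    2 * u * \prod_(k <- s) Num.min 1 (A * (`|f| + theta^-1) ^+ l * rho ^+ k).
  apply: (HA s (nth 0%N s q) _ `|f|) => //.
  - by rewrite lerDl invr_ge0 ltW.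
  - apply: le_trans (ler_normB _ _) _; rewrite mulr_natl mulr2n lerD //.
    by rewrite normrM -[leRHS]mulr1; apply: ler_pM.
  - exact: HC.
rewrite -[prod_mean _ _ _ (times s)](subrK (e (take q s) * e (drop q.+1 s))).
apply: le_trans (ler_normD _ _) _; apply: lerD; first exact: cov.
rewrite normrM (bigD1 (Ordinal qp)) //= lerDl.
by apply: sumr_ge0 => i _; rewrite mulr_ge0.
Qed.

(** * Moments of Birkhoff sums *)

(** The power expands into an [msum] over times. Ordering them leaves a starting time [h] and [m]
    gaps, and by stationarity all [n] values of [h] contribute equally. *)
Lemma Birkhoff_sum_moment {R : realType} {disp : measure_display}
    {Omega : measurableType disp} (P : probability Omega R) {d : nat}
    (X : nat -> {RV P >-> d.-tuple R}) (statX : stationary P X) m :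
  exists2 c : R, 0 <= c & forall (phi : d.-tuple R -> R) n,
  measurable_fun [set: d.-tuple R] phi -> (forall x, `|phi x| <= 1) ->
  ('E_P[fun w => (Birkhoff_sum X n phi w ^+ m.+1)%R] \is a fin_num)%E /\
  (`|'E_P[fun w => (Birkhoff_sum X n phi w ^+ m.+1)%R]| <=
    (c * (n%:R * msum (iota 0 n) m
                   (fun s => `|prod_mean P X phi (times s)|)))%:E)%E.
Proof.
have [c c0 Hc] := @msum_times R m; exists c => // phi n mphi phi1.
have -> : (fun w => Birkhoff_sum X n phi w ^+ m.+1) =
    (fun w => msum (iota 0 n) m.+1 (fun s => \prod_(k <- s) phi (X k w))).
  by apply/funext => w; rewrite msum_prod /Birkhoff_sum /index_iota subn0.
have [_ ->] := expectation_msum P (iota 0 n) m.+1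
  (fun s w => \prod_(k <- s) phi (X k w)) (prod_Lfun1 mphi phi1).
split=> //; rewrite abse_EFin lee_fin.
apply: le_trans (ler_norm_msum _ _ _) _.
apply: le_trans (Hc n (fun s => `|prod_mean P X phi s|) _ _) _ => //.
  by move=> s t st; rewrite (prod_mean_perm s t st).
rewrite ler_wpM2l //.
under eq_bigr do under eq_msum do rewrite prod_mean_shift //.
by rewrite sumr_const_seq size_iota.
Qed.

Lemma moment_estimate {R : realType} {disp : measure_display}
    {Omega : measurableType disp} (P : probability Omega R) {d : nat}
    (X : nat -> {RV P >-> d.-tuple R})
    {B : completeNormedModType R} (ev : B -> d.-tuple R -> R) (theta r : R) :
  stationary P X -> (forall f, measurable_fun [set: d.-tuple R] (ev f)) ->
  multiple_mixing P X ev theta r ->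
  forall m, exists2 K : R, 0 <= K & forall (n : nat) (f : B),
    ('E_P[ev f \o X 0%N] = 0)%E -> (forall x, `|ev f x| <= 1) ->
    (`|'E_P[fun w => (Birkhoff_sum X n (ev f) w ^+ m.+1)%R]| <=
      (K * moment_bound (n%:R * rv_norm P r (ev f \o X 0%N))
             (ln (`|f| + theta^-1)) m.+1)%:E)%E.
Proof.
move=> statX mev mixX m; have [th0 th1 r1 _] := mixX.
have [c c0 Hc] := Birkhoff_sum_moment P X statX m.
(* Pairs of $n$ and $\varphi$ form the index type, so that the constant of [moment_recursion]
   depends on neither. *)
pose J := {nf : nat * B | ('E_P[ev nf.2 \o X 0%N] = 0)%E /\
                          (forall x, `|ev nf.2 x| <= 1)}.
pose N (j : J) := (sval j).1; pose F (j : J) := (sval j).2.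
pose u j := rv_norm P r (ev (F j) \o X 0%N).
pose L j := ln (`|F j| + theta^-1).
pose Psi j s := `|prod_mean P X (ev (F j)) (times s)|.
pose a j p := (N j)%:R * msum (iota 0 (N j)) p (Psi j).
have u0 j : 0 <= u j by rewrite fine_ge0 // Lnorm_ge0.
(* A positive lower bound for all [L j], by which additive constants become multiples of [L j]. *)
pose L0 := ln theta^-1.
have L0_gt0 : 0 < L0 by rewrite ln_gt0 // invf_gt1.
have LL0 j : L0 <= L j.
  by rewrite ler_ln ?posrE ?invr_gt0 ?ltr_wpDl ?invr_gt0 // lerDr.
have Lge0 j : 0 <= L j by apply: le_trans (LL0 j); exact: ltW.
have a_ge0 j p : 0 <= a j p by rewrite mulr_ge0 // msum_ge0 // => s; exact: normr_ge0.
have a0 j : a j 0%N = 0.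
  have [Ef _] := svalP j; rewrite /a /= /Psi.
  have -> : prod_mean P X (ev (F j)) (times [::]) = 0.
    rewrite /prod_mean; under eq_fun do rewrite big_seq1.
    exact: (congr1 fine Ef).
  by rewrite normr0 mulr0.
have rec p : (0 < p)%N -> exists K : R, forall j,
    a j p <= K * ((N j)%:R * u j * L j ^+ p) +
             \sum_(q < p) a j q * a j (p - q.+1)%N.
  move=> p0; have [rho [A [l [rho0 rho1 A1 H]]]] :=
    prod_mean_times_bound P X ev theta r statX mev mixX p p0.
  have [K K0 HK] := sum_min_geom rho rho0 rho1.
  (* [ln W] equals [ln A + l * L j], and [1 + ln A] is at most [(1 + ln A) / L0 * L j]. *)
  pose K1 := K * ((1 + ln A) / L0 + l%:R).
  exists (2 * K1 ^+ p) => j.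
  pose W := A * (`|F j| + theta^-1) ^+ l.
  have t1 : 1 <= `|F j| + theta^-1.
    by rewrite -[leLHS]add0r lerD // -[leLHS]invr1 lef_pV2 ?posrE // ltW.
  have W1 : 1 <= W by rewrite mulr_ege1 // exprn_ege1.
  have sumW : \sum_(k <- iota 0 (N j)) Num.min 1 (W * rho ^+ k) <= K1 * L j.
    apply: le_trans (HK W (N j) W1) _; rewrite -mulrA ler_wpM2l //.
    rewrite /W lnM ?posrE ?exprn_gt0 ?(lt_le_trans ltr01) // lnXn ?(lt_le_trans ltr01) //.
    rewrite mulrDl addrA mulr_natl -/(L j) lerD2r // -mulrA ler_peMr ?addr_ge0 ?ln_ge0 //.
    by rewrite mulrC ler_pdivlMr // mul1r.
  have min0 k : 0 <= Num.min 1 (W * rho ^+ k).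
    by rewrite le_min ler01 mulr_ge0 ?exprn_ge0 ?(ltW rho0) // (le_trans ler01).
  have main : msum (iota 0 (N j)) p (Psi j) <= 2 * u j * (K1 * L j) ^+ p +
      \sum_(q < p) (N j)%:R * (msum (iota 0 (N j)) q (Psi j) *
                               msum (iota 0 (N j)) (p - q.+1) (Psi j)).
    apply: (@le_trans _ _ (msum (iota 0 (N j)) p (fun s =>
       2 * u j * \prod_(k <- s) Num.min 1 (W * rho ^+ k) +
       \sum_(q < p) Psi j (take q s) * Psi j (drop q.+1 s)))).
      apply: le_msum => s sp; have [Ef f1] := svalP j; exact: H.
    rewrite msumD msumZ msum_prod msum_sum; apply: lerD.
      rewrite ler_wpM2l ?mulr_ge0 // lerXn2r ?nnegrE ?sumr_ge0 //.
      by apply: le_trans sumW; exact: sumr_ge0.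
    apply: ler_sum => q _; rewrite -[X in (X%:R * _)%R](size_iota 0).
    by rewrite -msum_take_drop addnS -addSn subnKC.
  apply: le_trans (ler_wpM2l (ler0n _ _) main) _; rewrite mulrDr mulr_sumr.
  apply: lerD; first by rewrite exprMn le_eqVlt; apply/orP; left; apply/eqP; ring.
  by apply: ler_sum => q _; rewrite /a mulrACA -mulrA.
have x0 j : 0 <= (N j)%:R * u j by rewrite mulr_ge0.
have [K K0 HK] := moment_recursion a _ L x0 Lge0 a_ge0 a0 rec m.
exists (c * K); first exact: mulr_ge0.
move=> n f Ef f1; have [_ h] := Hc (ev f) n (mev f) f1.
apply: le_trans h _; rewrite lee_fin -mulrA ler_wpM2l //.
exact: (HK (exist _ (n, f) (conj Ef f1))).
Qed.

Theorem theorem4 (R : realType) (disp : measure_display)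
    (Omega : measurableType disp) (P : probability Omega R) (d : nat)
    (X : nat -> {RV P >-> d.-tuple R})
    (B : completeNormedModType R) (ev : B -> d.-tuple R -> R)
    (theta r : R)
    (statX : stationary P X)
    (evB : measurable_function_space ev)
    (mixX : multiple_mixing P X ev theta r) :
  forall p : nat, (1 <= p)%N ->
  exists K : R, forall (n : nat) (f : B), (1 <= n)%N ->
    ('E_P[ev f \o X 0%N] = 0)%E ->
    (forall x, `|ev f x| <= 1) ->
    ('E_P[fun w => (Birkhoff_sum X n (ev f) w ^+ (2 * p))%R]
      <= (K * \sum_(1 <= i < p.+1)
            n%:R ^+ i * rv_norm P r (ev f \o X 0%N) ^+ i
              * ln (`|f| + theta^-1) ^+ (2 * p - i))%:E)%E
    /\
    (`| 'E_P[fun w => (Birkhoff_sum X n (ev f) w ^+ (2 * p + 1))%R] |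
      <= (K * \sum_(1 <= i < p.+1)
            n%:R ^+ i * rv_norm P r (ev f \o X 0%N) ^+ i
              * ln (`|f| + theta^-1) ^+ (2 * p - i + 1))%:E)%E.
Proof.
move=> p p1; have [_ _ mev] := evB; have [th0 th1 r1 _] := mixX.
have [K1 K10 H1] := moment_estimate P X ev theta r statX mev mixX (2 * p).-1.
have [K2 K20 H2] := moment_estimate P X ev theta r statX mev mixX (2 * p).
exists (K1 + K2) => n f n1 Ef f1.
have {H1} := H1 n f Ef f1; have {H2} := H2 n f Ef f1.
rewrite prednK ?muln_gt0 // -[(2 * p).+1]addn1.
set x := n%:R; set u := rv_norm _ _ _; set L := ln _ => H2 H1.
have x0 : 0 <= x * u by rewrite mulr_ge0 ?ler0n // fine_ge0 // Lnorm_ge0.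
have L0 : 0 <= L.
  rewrite ln_ge0 // -[leLHS]add0r lerD // -[leLHS]invr1 lef_pV2 ?posrE //.
  exact: ltW.
have E1 : moment_bound (x * u) L (2 * p) =
    \sum_(1 <= i < p.+1) x ^+ i * u ^+ i * L ^+ (2 * p - i).
  rewrite /moment_bound mul2n doubleK.
  by apply: eq_bigr => i _; rewrite exprMn.
have E2 : moment_bound (x * u) L (2 * p + 1) =
    \sum_(1 <= i < p.+1) x ^+ i * u ^+ i * L ^+ (2 * p - i + 1).
  rewrite /moment_bound addn1 mul2n /= uphalf_double.
  (* Subtraction is truncated: [i <= p] is what makes [2 * p + 1 - i] equal to [2 * p - i + 1]. *)
  apply: eq_big_nat => i /andP[_ ip]; rewrite exprMn addn1 subSn //.
  by rewrite -addnn (leq_trans _ (leq_addr _ _)).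
rewrite -E1 -E2; split.
  apply: le_trans (le_trans (lee_abs _) H1) _.
  by rewrite lee_fin ler_wpM2r ?moment_bound_ge0 // lerDl.
apply: le_trans H2 _.
by rewrite lee_fin ler_wpM2r ?moment_bound_ge0 // lerDr.
Qed.
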